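(* Let $k\ge 2$ and let $N$, $j_1,\dots,j_k\ge 1$, $t_1,\dots,t_k\ge 0$ be integers with $j_k<j_{k-1}<\cdots<j_1<N-t_1<\cdots<N-t_k$. Write $S^{\searrow_k}(N)\equiv S^{\searrow_k}(N,N-t_1,\ldots,N-t_k,j_1,\ldots,j_k)$. Then $$\begin{aligned}\left|S^{\searrow_k}(N)\right|=\sum_{i=\max\{1,j_k-t_k\}}^{j_k}&\frac{(j_k-i+1)^2}{j_k(t_k+1)}\binom{i+2t_k-j_k}{t_k}\binom{i+j_k-2}{j_k-1}\\ &\times\left|S^{\searrow_{k-1}}(N-t_k-i,\;N-t_1-i+1,\ldots,N-t_{k-1}-i+1,\;j_1-j_k,\,j_2-j_k,\ldots,j_{k-1}-j_k)\right|.\end{aligned}$$ In particular, for $k=2$, $$\begin{aligned}\left|S^{\searrow_2}(N)\right|=&\sum_{i_1=\max\{1,j_2-t_2\}}^{j_2}\frac{(j_2-i_1+1)^2}{j_2(t_2+1)}\binom{i_1+2t_2-j_2}{t_2}\binom{i_1+j_2-2}{j_2-1}\\ &\times\sum_{i_0=\max\{1,(j_1-j_2)-(t_1-t_2-1)\}}^{j_1-j_2}C_{N-t_1-i_1-i_0+1}\,\frac{(j_1-j_2-i_0+1)^2}{(j_1-j_2)(t_1-t_2)}\\ &\qquad\times\binom{i_0+2(t_1-t_2-1)-(j_1-j_2)}{t_1-t_2-1}\binom{i_0+j_1-j_2-2}{j_1-j_2-1}.\end{aligned}$$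
   Context: $S_N(312)$ is the set of permutations $\sigma=\sigma_1\ldots\sigma_N$ of $1,\dots,N$ for which there are no indices $i_1<i_2<i_3$ with $\sigma_{i_1}>\sigma_{i_3}>\sigma_{i_2}$. For $m\ge 1$, a positive integer $M$, positions $p_1<\cdots<p_m$ in $[1,M]$ and values $v_m<\cdots<v_1<p_1$ (positive integers), $S^{\searrow_m}(M,p_1,\ldots,p_m,v_1,\ldots,v_m)=\{\sigma\in S_M(312):\sigma_{p_1}=v_1,\ldots,\sigma_{p_m}=v_m\}$. $C_n=\frac{1}{n+1}\binom{2n}{n}$ is the Catalan number. *)

(* Defs.v *)
From mathcomp Require Import all_boot all_order all_fingroup all_algebra.

Set Implicit Arguments.
Unset Strict Implicit.
Unset Printing Implicit Defensive.

Import GRing.Theory.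

Definition avoids312 (M : nat) (s : 'S_M) : bool :=
  ~~ [exists i1 : 'I_M, exists i2 : 'I_M, exists i3 : 'I_M,
        [&& i1 < i2, i2 < i3, s i2 < s i3 & s i3 < s i1]].

(* 'I_M is 0-based whereas permutations act on 1, ..., M, so position and
   value x of the paper correspond to the ordinal i with i.+1 = x.  The
   positions p_1, ..., p_m are p 1, ..., p m (similarly for v); p and v at other
   arguments are irrelevant.  A position outside [1, M] gives the empty set. *)
Definition Sdesc (M m : nat) (p v : nat -> nat) : {set 'S_M} :=
  [set s : 'S_M | avoids312 s &
     [forall a : 'I_m, exists i : 'I_M,
        (i.+1 == p a.+1) && ((s i).+1 == v a.+1)]].

Definition catalan (n : nat) : rat :=
  (n.+1%:R^-1 * 'C(2 * n, n)%:R)%R.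

(* Main.v *)
Require Import Defs.
From mathcomp Require Import all_boot all_order all_fingroup all_algebra.
From mathcomp Require Import zify ring.

(** The only structural input is the decomposition of a 312-avoiding word at
    its smallest letter: [s = L 1 R] avoids 312 exactly when [L] and [R] do and
    every entry of [L] is below every entry of [R].  So 312-avoiding words are
    binary trees, and the number of words through prescribed points satisfies
    a recurrence over the position of the letter 1.

    Let [(p, j)] be the last and lowest of the points, let [t] be the number of
    positions after [p], and let [Q] be the other points, all to the left of
    [p], above [j], and at positions at least [j].  By [num_words_lowest], the
    number of words of length [p + t] through all these points is the sum over
    [r < j] of [ballot (j - 1) r * ballot t r] times the number of words of
    length [p - (j - r)] through the points of [Q] moved left by [j - r - 1]
    and down by [j].  If [j = 1], the point is the letter 1, [L] carries [Q],
    and [R] is free.  If [j > 1], the letter 1 is on one side of all the points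
    ([num_words_value_gt1]), which expresses the count by smaller instances in
    which the residual words are the same ones; the coefficients then agree by
    two identities for ballot numbers, the convolution with Catalan numbers
    ([ballot_convolution]) and the Pascal rule ([ballot_pascal]).

    The closed form [(r + 1) / (n + 1) * C(2n - r, n)] of [ballot n r]
    ([mul_ballot]) turns this sum, with [i = j - r], into the stated one. *)

Set Implicit Arguments.
Unset Strict Implicit.
Unset Printing Implicit Defensive.

Import GRing.Theory Num.Theory.

(** * Ballot numbers *)

(** The coefficient of [x ^ n] in [x ^ r * c(x) ^ r.+1], where [c] is the
    Catalan series.  The recursion used here, [ballot n.+1 r] being the sum of
    [ballot n s] over [s >= r - 1], is the Pascal-like rule of [ballot_pascal]
    unrolled, which makes it structural in [n].  As [0.-1 = 0], the rows
    [n.+1] satisfy [ballot n.+1 0 = ballot n.+1 1]. *)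
Fixpoint ballot (n r : nat) : nat :=
  if n is n'.+1 then \sum_(r.-1 <= s < n) ballot n' s else (r == 0).

Lemma ballot_gt n r : n < r -> ballot n r = 0.
Proof.
case: n r => [|n] [|r] //= lt_nr.
by rewrite big_geq.
Qed.

Lemma ballot_pascal n r :
  ballot n.+1 r.+1 = ballot n r + ballot n.+1 r.+2.
Proof.
have [le_rn|lt_nr] := leqP r n; first by rewrite /= big_ltn.
by rewrite !ballot_gt //; lia.
Qed.

Lemma ballot_S0 n : ballot n.+1 0 = ballot n.+1 1.
Proof. by []. Qed.

(** This is [c * (x ^ r * c ^ r.+1) = x ^ r * c ^ r.+2] coefficientwise.  Both
    sides obey the same Pascal rule in [(n, r)], so the induction is on [n]
    and, inside, downwards on [r] from [r > n] where both sides vanish. *)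
Lemma ballot_convolution n r :
  \sum_(q < n.+1) ballot q 0 * ballot (n - q) r = ballot n.+1 r.+1.
Proof.
elim: n r => [|n IHn] r.
  rewrite big_ord1 /= mul1n; case: r => [|r]; first by rewrite big_nat1.
  by rewrite big_geq.
have [d] := ubnP (n.+2 - r); elim: d r => // d IHd r lt_d.
have [le_rn|lt_nr] := leqP r n.+1; last first.
  rewrite ballot_gt ?big1 // => q _.
  by rewrite (@ballot_gt (n.+1 - q)) ?muln0 //; lia.
rewrite ballot_pascal -IHd; last by lia.
rewrite big_ord_recr [in RHS]big_ord_recr; set X := ballot n.+1.
rewrite /= subnn /=.
case: r le_rn {lt_d} => [|r] le_rn.
  rewrite addnC muln0 addn0 muln1; congr (_ + _).
  by apply: eq_bigr => q _; rewrite (subSn (ltn_ord q : q <= n)).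
rewrite /X !muln0 !addn0 -IHn -big_split /=; apply: eq_bigr => q _.
by rewrite (subSn (ltn_ord q : q <= n)) ballot_pascal mulnDr.
Qed.

Arguments ballot : simpl never.

(** The reflection principle: the bad paths are counted by the second
    binomial.  Both binomials follow Pascal's rule, so again [n] goes up and
    [r] down. *)
Lemma ballot_bin n r : r <= n ->
  ballot n r + 'C(2 * n - r, n.+1) = 'C(2 * n - r, n).
Proof.
elim: n r => [|n IHn] r; first by rewrite leqn0 => /eqP ->.
have [d] := ubnP (n.+1 - r); elim: d r => // d IHd r lt_d le_rn.
have step s : s <= n -> n - s < d.+1 ->
    ballot n.+1 s.+1 + 'C(2 * n.+1 - s.+1, n.+2) = 'C(2 * n.+1 - s.+1, n.+1).
  move=> le_sn lt_s; have -> : 2 * n.+1 - s.+1 = (2 * n - s).+1 by lia.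
  rewrite ballot_pascal !binS -(IHn s le_sn).
  have [lt_sn|le_ns] := ltnP s n; last first.
    (* Here s = n, the top of the row, where the next ballot number is 0. *)
    rewrite (@ballot_gt n.+1 s.+2); last by lia.
    by rewrite (@bin_small _ n.+2) ?(@bin_small _ n.+1); lia.
  have := IHd s.+2; have -> : 2 * n.+1 - s.+2 = 2 * n - s by lia.
  lia.
case: r lt_d le_rn => [|r] lt_d le_rn; last by apply: step; lia.
(* For r = 0 the two central binomials of row 2n+1 are equal, which makes
   the claim agree with the one for r = 1. *)
rewrite ballot_S0.
have E : 2 * n.+1 - 0 = (2 * n.+1 - 1).+1 by lia.
rewrite E !binS; have := step 0 isT; have := @bin_sub (2 * n.+1 - 1) n.
have -> : 2 * n.+1 - 1 - n = n.+1 by lia.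
lia.
Qed.

Lemma mul_ballot n r : r <= n ->
  n.+1 * ballot n r = r.+1 * 'C(2 * n - r, n).
Proof.
move=> le_rn; have := ballot_bin le_rn.
have := mul_bin_left (2 * n - r) n.
have -> : 2 * n - r - n = n - r by lia.
nia.
Qed.

(** * Words avoiding 312 *)

(** The occurrences of 312 are sorted by their first entry, so that a word can
    be cut at its letter 1 by induction on the part before it. *)
Fixpoint av312 (s : seq nat) : bool :=
  if s is x :: s' then
    pairwise (fun y z => ~~ (y < z < x)) s' && av312 s'
  else true.

Lemma av312P s :
  reflect (forall i1 i2 i3, i1 < i2 -> i2 < i3 -> i3 < size s ->
             ~~ (nth 0 s i2 < nth 0 s i3 < nth 0 s i1))
          (av312 s).
Proof.
apply: (iffP idP).
  elim: s => //= x s IHs /andP[/(pairwiseP 0) Hx /IHs Hs].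
  move=> [|i1] [|i2] [|i3] //= lt12 lt23 lt3; last exact: Hs.
  by apply: Hx; rewrite ?inE //; lia.
elim: s => //= x s IHs H; apply/andP; split.
  apply/(pairwiseP 0) => i2 i3; rewrite !inE => _ lt3 lt23.
  exact: (H 0 i2.+1 i3.+1).
by apply: IHs => i1 i2 i3 *; apply: (H i1.+1 i2.+1 i3.+1).
Qed.

Lemma av312_map (f : nat -> nat) s :
  {mono f : x y / x < y} -> av312 [seq f x | x <- s] = av312 s.
Proof.
move=> f_mono; elim: s => //= x s ->; congr (_ && _).
by rewrite pairwise_map; apply: eq_pairwise => y z /=; rewrite !f_mono.
Qed.

(** Being minimal, the letter 1 can only be the middle entry of an occurrence
    of 312, and such an occurrence [x, 1, z] exists exactly when some entry of
    [L] exceeds some entry of [R].  When [L] is entirely below [R], no other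
    occurrence straddles [L] and [R] either. *)
Lemma av312_cat1 L R :
    all (leq 2) L -> all (leq 2) R -> uniq (L ++ R) ->
  av312 (L ++ 1 :: R) = [&& av312 L, av312 R & allrel ltn L R].
Proof.
move=> gt1L gt1R; elim: L gt1L => [_ _|x L IHL] /=.
  rewrite [allrel _ _ _]/= andbT; case: (av312 R); rewrite ?andbF // andbT.
  by apply/(pairwiseP 0) => y z _ _ _; lia.
move=> /andP[gt1x gt1L] /andP[xLR uLR]; rewrite IHL //.
rewrite allrel_consl pairwise_cat pairwise_cons allrel_consr.
have -> : all (fun z => ~~ (1 < z < x)) R = all (ltn x) R.
  apply: eq_in_all => z zR.
  have : z != x by apply: contraNneq xLR => <-; rewrite mem_cat zR orbT.
  by have := allP gt1R z zR; rewrite /=; lia.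
have -> : all ((fun y z => ~~ (y < z < x))^~ 1) L.
  by apply/allP => y /(allP gt1L) /=; lia.
have [lt_xR|] := boolP (all (ltn x) R); last by rewrite ?andbF.
have -> : allrel (fun y z => ~~ (y < z < x)) L R.
  by apply/allrelP => y z _ /(allP lt_xR) /=; lia.
have -> : pairwise (fun y z => ~~ (y < z < x)) R.
  apply: (@sub_in_pairwise _ (ltn x) (fun _ _ => true)) => //.
    by move=> y z; rewrite !inE /=; lia.
  by elim: (R) => //= a l ->; rewrite all_predT.
by rewrite /= andbT andbA.
Qed.

(** Sorting both pieces gives a sorted rearrangement of the interval, hence
    the interval itself; so each piece fills a subinterval. *)
Lemma perm_iota_cat a n L R :
    perm_eq (L ++ R) (iota a n) -> allrel ltn L R ->
  perm_eq L (iota a (size L)) /\ perm_eq R (iota (a + size L) (n - size L)).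
Proof.
move=> permLR ltLR.
have sorted_sort s : sorted leq (sort leq s).
  by apply: sort_sorted; apply: leq_total.
have E : sort leq L ++ sort leq R = iota a n.
  apply: (sorted_eq leq_trans anti_leq); last 1 first.
  - by apply: perm_trans permLR; apply: perm_cat; rewrite perm_sort.
  - rewrite (sorted_pairwise leq_trans) pairwise_cat.
    rewrite -!(sorted_pairwise leq_trans) !sorted_sort !andbT.
    apply/allrelP => x y; rewrite !mem_sort => xL yR.
    exact/ltnW/(allrelP ltLR).
  - exact: iota_sorted.
have szL : size L <= n.
  by rewrite -(size_iota a n) -(perm_size permLR) size_cat leq_addr.
have EL : sort leq L = iota a (size L).
  have := congr1 (take (size L)) E.
  by rewrite take_size_cat ?size_sort // take_iota (minn_idPl szL).
have ER : sort leq R = iota (a + size L) (n - size L).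
  have := congr1 (drop (size L)) E.
  by rewrite drop_size_cat ?size_sort // drop_iota.
by split; [rewrite -EL | rewrite -ER]; rewrite perm_sym perm_sort.
Qed.

(** Entries are 1-based, so that [words n] lists the one-line notations of
    [S_n(312)]. *)
Definition words (n : nat) : seq (seq nat) :=
  [seq s <- permutations (iota 1 n) | av312 s].

Lemma mem_words n s :
  (s \in words n) = av312 s && perm_eq s (iota 1 n).
Proof. by rewrite mem_filter mem_permutations. Qed.

Lemma words_uniq n : uniq (words n).
Proof. exact/filter_uniq/permutations_uniq. Qed.

Lemma size_word n s : s \in words n -> size s = n.
Proof. by rewrite mem_words => /andP[_ /perm_size]; rewrite size_iota. Qed.

Lemma word_gt0 n s (x : nat) : s \in words n -> x \in s -> 0 < x.
Proof.
rewrite mem_words => /andP[_ /perm_mem ->].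
by rewrite mem_iota => /andP[].
Qed.

Lemma nth_word_gt0 n s i : s \in words n -> i < n -> 0 < nth 0 s i.
Proof.
by move=> ws lt_in; rewrite (word_gt0 ws) // mem_nth // (size_word ws).
Qed.

Lemma mono_succn : {mono succn : x y / x < y}.
Proof. by []. Qed.

(** The word [L' 1 R'], where [L'] and [R'] are the copies of [L] and [R] on
    the value intervals [2 .. m.+1] and [m.+2 ..], for [m] the size of [L]. *)
Definition glue (m : nat) (L R : seq nat) : seq nat :=
  map succn L ++ 1 :: map (addn m.+1) R.

Lemma glue_words n m L R : m <= n -> L \in words m -> R \in words (n - m) ->
  glue m L R \in words n.+1.
Proof.
move=> le_mn wL wR.
have gtL : all (leq 2) (map succn L).
  by apply/allP => _ /mapP[x xL ->]; exact: (word_gt0 wL xL).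
have gtR : all (leq 2) (map (addn m.+1) R).
  by apply/allP => _ /mapP[x xR ->]; have := word_gt0 wR xR; lia.
have pLR : perm_eq (map succn L ++ map (addn m.+1) R) (iota 2 n).
  rewrite -(subnKC le_mn) iotaD.
  move: wL wR; rewrite !mem_words => /andP[_ pL] /andP[_ pR].
  have -> : 2 + m = m.+1 + 1 by lia.
  rewrite (iotaDl m.+1 1) -[iota 2 m]/(iota (1 + 1) m) (iotaDl 1 1).
  by apply: perm_cat; apply: perm_map.
rewrite mem_words /glue av312_cat1 ?(perm_uniq pLR) ?iota_uniq //.
rewrite (av312_map _ (ltn_add2l m.+1)) (av312_map _ mono_succn).
move: (wL) (wR); rewrite !mem_words => /andP[-> pL] /andP[-> pR] /=.
apply/andP; split; last first.
  rewrite (permPl (_ : perm_eq _ (1 :: (map succn L ++ map (addn m.+1) R)))).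
    by rewrite perm_cons.
  by rewrite -cat1s perm_catCA.
apply/allrelP => _ _ /mapP[x xL ->] /mapP[y yR ->].
have := word_gt0 wR yR; move: xL; rewrite (perm_mem pL) mem_iota; lia.
Qed.

(** Together with [glue_words]: cutting at the letter 1 is the binary tree
    decomposition of a 312-avoiding word. *)
Lemma words_glue n s : s \in words n.+1 ->
  exists L R, [/\ index 1 s <= n, L \in words (index 1 s),
    R \in words (n - index 1 s) & s = glue (index 1 s) L R].
Proof.
rewrite mem_words => /andP[avs ps].
have s1 : 1 \in s by rewrite (perm_mem ps) mem_iota.
have us : uniq s by rewrite (perm_uniq ps) iota_uniq.
case/splitPr: s / s1 avs ps us => L R avs ps us.
have pLR : perm_eq (L ++ R) (iota 2 n).
  by rewrite -(perm_cons 1) -[X in perm_eq _ X]/(iota 1 n.+1) -(permPr ps)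
     -(cat1s 1 R) perm_sym perm_catCA.
have gt1 x : x \in L ++ R -> 1 < x.
  by rewrite (perm_mem pLR) mem_iota => /andP[].
have gtL : all (leq 2) L by apply/allP => x xL; rewrite gt1 // mem_cat xL.
have gtR : all (leq 2) R.
  by apply/allP => x xR; rewrite gt1 // mem_cat xR orbT.
move: avs; rewrite av312_cat1 ?(perm_uniq pLR) ?iota_uniq //.
case/and3P => avL avR ltLR.
have [pL pR] := perm_iota_cat pLR ltLR.
have -> : index 1 (L ++ 1 :: R) = size L.
  rewrite index_cat /= addn0; case: ifP => // /(allP gtL).
  by [].
have EL : L = map succn (map predn L).
  rewrite -map_comp -[LHS]map_id; apply/eq_in_map => x /(allP gtL) /=; lia.
have ER : R = map (addn (size L).+1) (map (subn^~ (size L).+1) R).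
  rewrite -map_comp -[LHS]map_id; apply/eq_in_map => x.
  by rewrite (perm_mem pR) mem_iota /=; lia.
exists (map predn L), (map (subn^~ (size L).+1) R); split.
- by rewrite -(size_iota 2 n) -(perm_size pLR) size_cat leq_addr.
- rewrite mem_words -(av312_map _ mono_succn) -?EL ?avL //=.
  rewrite -[iota 1 _](mapK (succnK)) -(iotaDl 1 1).
  exact: perm_map.
- rewrite mem_words -(av312_map _ (ltn_add2l (size L).+1)) -?ER ?avR /=.
  rewrite -[iota 1 _](mapK (addKn (size L).+1)) -iotaDl addn1.
  exact: perm_map.
- by rewrite /glue -EL -ER.
Qed.

Definition glues (n m : nat) : seq (seq nat) :=
  [seq glue m L R | L <- words m, R <- words (n - m)].

Lemma index_glue n m L R : L \in words m -> R \in words n ->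
  index 1 (glue m L R) = m.
Proof.
move=> wL wR; rewrite index_cat size_map (size_word wL) /= addn0.
by case: ifP => // /mapP[x /(word_gt0 wL) x_gt0] [x0]; rewrite -x0 in x_gt0.
Qed.

Lemma glues_uniq n m : m <= n -> uniq (glues n m).
Proof.
move=> le_mn; apply: allpairs_uniq; rewrite ?words_uniq // => -[L R] [L' R'].
move=> /allpairsP[[L1 R1] /= [wL wR [-> ->]]].
move=> /allpairsP[[L2 R2] /= [wL' wR' [-> ->]]].
move/eqP; rewrite eqseq_cat ?size_map ?(size_word wL) ?(size_word wL') //.
case/andP => /eqP/(inj_map succn_inj) -> /eqP[] /(inj_map (@addnI _)) ->.
by [].
Qed.

(** The words are sorted by the position of their letter 1. *)
Lemma count_words_glue (a : pred (seq nat)) n :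
  count a (words n.+1) = \sum_(0 <= m < n.+1) count a (glues n m).
Proof.
rewrite big_mkord.
rewrite -sum1_count big_seq_cond.
rewrite (partition_big (fun s => inord (index 1 s) : 'I_n.+1) xpredT) //=.
apply: eq_bigr => m _; rewrite -sum1_count.
have perm_fiber :
    perm_eq [seq s <- words n.+1 | index 1 s == m] (glues n m).
  apply: uniq_perm; first exact/filter_uniq/words_uniq.
    by apply: glues_uniq; have := ltn_ord m; lia.
  move=> s; rewrite mem_filter; apply/andP/allpairsP => [[/eqP im]|].
    by case/words_glue => L [R [_ wL wR ->]]; exists (L, R); rewrite -im.
  case=> -[L R] /= [wL wR ->]; rewrite (index_glue wL wR) eqxx.
  by rewrite glue_words // -ltnS.
rewrite -(perm_big _ perm_fiber) /= big_filter_cond [in RHS]big_seq_cond.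
apply: eq_bigl => s; case ws: (s \in _) => //=; rewrite andbC; congr (_ && _).
have [L [R [le_n _ _ _]]] := words_glue ws.
by rewrite -val_eqE /= inordK.
Qed.

Lemma count_glues (a b d : pred (seq nat)) n m :
    {in words m & words (n - m),
      forall L R, a (glue m L R) = b L && d R} ->
  count a (glues n m) = count b (words m) * count d (words (n - m)).
Proof.
rewrite /glues; elim: (words m) => //= L Ls IHL H.
rewrite count_cat IHL => [|L' R L'Ls]; last by apply: H; rewrite inE L'Ls orbT.
rewrite mulnDl; congr (_ + _); rewrite count_map.
have -> : b L * count d (words (n - m)) =
          count (fun R => b L && d R) (words (n - m)).
  by case: (b L); rewrite ?mul1n ?mul0n ?count_pred0.
by apply: eq_in_count => R wR /=; rewrite H ?mem_head.
Qed.

(** * Words through prescribed points *)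

(** A point is a pair (position, value), both 1-based.  The leading 0 makes
    [nth] agree with 1-based positions, and makes position 0 and positions
    beyond the end carry the value 0, which is no entry of a word. *)
Definition hit (s : seq nat) (q : nat * nat) : bool :=
  nth 0 (0 :: s) q.1 == q.2.

Definition num_words (n : nat) (P : seq (nat * nat)) : nat :=
  count (fun s => all (hit s) P) (words n).

(** Cutting at the letter 1 is Segner's recurrence for the Catalan numbers,
    here the case [r = 0] of [ballot_convolution]. *)
Lemma num_words_nil n : num_words n [::] = ballot n 0.
Proof.
have [d] := ubnP n; elim: d n => // d IHd [|n] lt_d; first by [].
rewrite /num_words count_words_glue big_mkord ballot_S0 -ballot_convolution.
apply: eq_bigr => m _; rewrite (@count_glues _ xpredT xpredT) //.
by rewrite -!IHd //; have := ltn_ord m; lia.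
Qed.

Lemma hit_glue_left n m L R x y : L \in words m -> R \in words n ->
  0 < x <= m -> 0 < y ->
  hit (glue m L R) (x, y) = hit L (x, y.-1).
Proof.
move=> wL wR; case: x y => [|x] [|y] //= lt_xm _.
rewrite /hit /= nth_cat size_map (size_word wL) lt_xm.
by rewrite (nth_map 0) ?(size_word wL).
Qed.

Lemma nth_word_le n s x : s \in words n -> nth 0 (0 :: s) x <= n.
Proof.
move=> ws.
have [lt_x|] := ltnP x (size (0 :: s)); last by move/(nth_default 0) ->.
have := mem_nth 0 lt_x; rewrite inE => /orP[/eqP -> //|].
move: ws; rewrite mem_words => /andP[_ /perm_mem ->].
by rewrite mem_iota => /andP[_].
Qed.

Lemma hit_glue_mid n m L R y : L \in words m -> R \in words n ->
  hit (glue m L R) (m.+1, y) = (y == 1).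
Proof.
move=> wL wR.
by rewrite /hit /= nth_cat size_map (size_word wL) ltnn subnn eq_sym.
Qed.

Lemma hit_glue_right n m L R x y : L \in words m -> R \in words n ->
  m.+1 < x -> m.+1 < y ->
  hit (glue m L R) (x, y) = hit R (x - m.+1, y - m.+1).
Proof.
move=> wL wR; case: x => [|x] //=; rewrite ltnS => lt_mx lt_my.
rewrite /hit /= nth_cat size_map (size_word wL) ltnNge (ltnW lt_mx) /=.
have -> : x - m = (x - m.+1).+1 by lia.
rewrite subSS /=.
have -> : x - m = (x - m.+1).+1 by lia.
rewrite /=; have [lt_x|le_x] := ltnP (x - m.+1) (size R).
  by rewrite (nth_map 0) //; lia.
by rewrite !nth_default ?size_map //; lia.
Qed.

Lemma hit_glue_right_low n m L R x y : L \in words m -> R \in words n ->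
  m.+1 < x -> 0 < y <= m.+1 ->
  hit (glue m L R) (x, y) = false.
Proof.
move=> wL wR; case: x => [|x] //=; rewrite ltnS => lt_mx lt_my.
rewrite /hit /= nth_cat size_map (size_word wL) ltnNge (ltnW lt_mx) /=.
have -> : x - m = (x - m.+1).+1 by lia.
rewrite /=; have [lt_x|le_x] := ltnP (x - m.+1) (size R).
  rewrite (nth_map 0) //; rewrite (size_word wR) in lt_x.
  by have := nth_word_gt0 wR lt_x; lia.
by rewrite nth_default ?size_map //; lia.
Qed.

(** A point of value 1 fixes the place of the cut, and all other points, being
    to its left, constrain only the left part. *)
Lemma num_words_value1 p t Q :
    0 < p -> all (fun q => (0 < q.1 < p) && (1 < q.2)) Q ->
  num_words (p + t) ((p, 1) :: Q) =
  num_words p.-1 [seq (q.1, q.2.-1) | q <- Q] * ballot t 0.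
Proof.
case: p => // p _ /allP HQ.
rewrite {1}/num_words addSn count_words_glue big_mkord.
have lt_p : p < (p + t).+1 by rewrite ltnS leq_addr.
(* The cut with left part of size p is the only one that puts 1 there. *)
rewrite (bigD1 (Ordinal lt_p)) //= [X in _ + X]big1 => [|m ne_mp].
  rewrite addn0 -num_words_nil -[in num_words t](addKn p t).
  apply: count_glues => L R wL wR /=.
  rewrite (hit_glue_mid _ wL wR) eqxx andbT all_map; apply: eq_in_all => -[x y].
  by move=> /HQ /= /andP[/andP[x0 xp] y1]; apply: hit_glue_left => //; lia.
rewrite (@count_glues _ pred0 pred0) ?count_pred0 // => L R wL wR /=.
have ne_pm : nat_of_ord m <> p.
  by move=> E; move: ne_mp; rewrite -val_eqE /= E eqxx.
have [lt_mp|le_pm] := ltnP m p.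
  by rewrite (hit_glue_right_low wL wR).
rewrite (hit_glue_left wL wR) //; last by lia.
suff -> : hit L (p.+1, 0) = false by [].
by rewrite /hit /=; have := @nth_word_gt0 _ _ p wL; lia.
Qed.

(** If the point [(p, j)] is not the letter 1, it lies left or right of it.
    Right parts lie above left parts, so if it lies in the right part, beyond
    a left part of size [m], then [m.+1 < j], and the points of [Q], having
    positions at least [j], are in the right part too.  If it lies in the left
    part, of size [p + u], so do the points of [Q], which are further left.
    Hence in both cases the other part is free. *)
Lemma num_words_value_gt1 p j t Q : 1 < j < p ->
    all (fun q => (j <= q.1 < p) && (j < q.2)) Q ->
  num_words (p + t) ((p, j) :: Q) =
  \sum_(m < j.-1) ballot m 0 *
     num_words (p - m.+1 + t)
       [seq (q.1 - m.+1, q.2 - m.+1) | q <- (p, j) :: Q] +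
  \sum_(u < t) ballot (t.-1 - u) 0 *
     num_words (p + u) [seq (q.1, q.2.-1) | q <- (p, j) :: Q].
Proof.
move=> /andP[j_gt1 lt_jp] /allP HQ.
have EN : p + t = (p + t).-1.+1 by lia.
rewrite {1}/num_words {1}EN count_words_glue -EN.
(* Sizes m of the left part: m < j - 1 puts the point to the right of the
   letter 1, m >= p puts it to the left, the others are impossible. *)
rewrite (@big_cat_nat _ _ _ p) ?leq_addr //=.
rewrite (@big_cat_nat _ _ _ j.-1 0 p) //=; last by lia.
rewrite [X in _ + X + _]big_nat_cond [X in _ + X + _]big1 ?addn0 => [|m].
  congr (_ + _).
    rewrite big_mkord; apply: eq_bigr => m _; have := ltn_ord m => lt_mj.
    have En : p - m.+1 + t = (p + t).-1 - m by lia.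
    rewrite -num_words_nil En; apply: count_glues => L R wL wR.
    rewrite /= all_map; congr (_ && _).
      by rewrite (hit_glue_right wL wR) //; lia.
    apply: eq_in_all => -[x y] /HQ /= /andP[/andP[? ?] ?].
    by rewrite (hit_glue_right wL wR) //; lia.
  rewrite -{1}[p]add0n big_addn addKn big_mkord; apply: eq_bigr => u _.
  have := ltn_ord u => lt_ut.
  have En : t.-1 - u = (p + t).-1 - (u + p) by lia.
  rewrite mulnC -num_words_nil En (addnC p u); apply: count_glues => L R wL wR.
  rewrite /= andbT all_map; congr (_ && _).
    by rewrite (hit_glue_left wL wR) //; lia.
  apply: eq_in_all => -[x y] /HQ /= /andP[/andP[? ?] ?].
  by rewrite (hit_glue_left wL wR) //; lia.
rewrite andbT => /andP[le_jm lt_mp].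
rewrite (@count_glues _ pred0 pred0) ?count_pred0 // => L R wL wR /=.
suff -> : hit (glue m L R) (p, j) = false by [].
have [E|lt_p] := eqVneq p m.+1.
  by rewrite E (hit_glue_mid _ wL wR); lia.
by rewrite (hit_glue_right_low wL wR) //; lia.
Qed.

(** The removal of the lowest point.  In a word through [(p, j)] and [Q], the
    entries below [j] and left of [p] occupy the first [j - r - 1] positions,
    where [r] counts the entries below [j] on the right of [p]; removing these,
    the point and all that is on its right leaves a word through the shifted
    points of [Q].  What is removed has [ballot j.-1 r * ballot t r]
    possibilities.  The proof by induction on [j] never looks at that
    structure.  Cutting at the letter 1 leads to smaller instances whose sums
    involve the same residual counts [X r]: a letter 1 left of the point leaves
    [r] unchanged, a letter 1 right of the point is one of the [r] small
    entries there.  So only the coefficients of each [X r] are to be compared,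
    and these agree by [ballot_convolution], used once on each side of the
    point, and [ballot_pascal]. *)
Lemma num_words_lowest p j t Q : 0 < j < p ->
    all (fun q => (j <= q.1 < p) && (j < q.2)) Q ->
  num_words (p + t) ((p, j) :: Q) =
  \sum_(r < j) ballot j.-1 r * ballot t r *
     num_words (p - (j - r)) [seq (q.1 - (j - r) + 1, q.2 - j) | q <- Q].
Proof.
have [d] := ubnP j; elim: d p j t Q => // d IHd p [|[|j]] t Q //= lt_d lt_jp HQ.
  rewrite num_words_value1 ?big_ord1 //; first 1 last.
  - by lia.
  rewrite mul1n mulnC subn0 subn1; congr (_ * num_words _ _).
  apply/eq_in_map => q /(allP HQ) /andP[/andP[? ?] ?].
  by congr (_, _); lia.
rewrite num_words_value_gt1 //.
pose X r := num_words (p - (j.+2 - r))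
              [seq (q.1 - (j.+2 - r) + 1, q.2 - j.+2) | q <- Q].
(* The letter 1 is left of the point. *)
have -> : \sum_(m < j.+1) ballot m 0 *
     num_words (p - m.+1 + t)
       [seq (q.1 - m.+1, q.2 - m.+1) | q <- (p, j.+2) :: Q]
   = \sum_(r < j.+1) ballot j.+1 r.+1 * ballot t r * X r.
  under eq_bigr => m _.
    have := ltn_ord m => lt_mj; rewrite /= IHd; first 1 last.
    - by lia.
    - by lia.
    - apply/allP => _ /mapP[q /(allP HQ) /andP[/andP[? ?] ?] ->] /=.
      by lia.
    have Ej : j.+2 - m.+1 = (j - m).+1 by lia.
    rewrite Ej /=.
    under eq_bigr => r _.
      have := ltn_ord r => lt_r.
      have -> : num_words (p - m.+1 - ((j - m).+1 - r))
        [seq (q.1 - ((j - m).+1 - r) + 1, q.2 - (j - m).+1)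
           | q <- [seq (q.1 - m.+1, q.2 - m.+1) | q <- Q]] = X r.
        rewrite /X -map_comp; congr (num_words _ _); first by lia.
        apply/eq_in_map => q /(allP HQ) /andP[/andP[? ?] ?] /=.
        by congr (_, _); lia.
      over.
    (* Make the range of r independent of m; the added terms vanish. *)
    rewrite (big_ord_widen j.+1 (fun r => ballot (j - m) r * ballot t r * X r));
      last by lia.
    rewrite big_mkcond.
    over.
  rewrite /=; under eq_bigr => m _ do rewrite big_distrr.
  rewrite exchange_big /=; apply: eq_bigr => r _.
  rewrite -ballot_convolution !big_distrl /=; apply: eq_bigr => m _.
  case: ifP => [_|]; first by rewrite !mulnA.
  move/negbT => lt_r; rewrite (@ballot_gt (j - m)) ?muln0 ?mul0n //; lia.
(* The letter 1 is right of the point: one more small entry there, so the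
   index r of the smaller instance contributes to X r.+1. *)
have -> : \sum_(u < t) ballot (t.-1 - u) 0 *
     num_words (p + u) [seq (q.1, q.2.-1) | q <- (p, j.+2) :: Q]
   = \sum_(r < j.+1) ballot j r * ballot t r.+1 * X r.+1.
  under eq_bigr => u _.
    rewrite /= IHd; first 1 last.
    - by lia.
    - by lia.
    - apply/allP => _ /mapP[q /(allP HQ) /andP[/andP[? ?] ?] ->] /=.
      by lia.
    rewrite /=; under eq_bigr => r _.
      have -> : num_words (p - (j.+1 - r))
        [seq (q.1 - (j.+1 - r) + 1, q.2 - j.+1)
           | q <- [seq (q.1, q.2.-1) | q <- Q]] = X r.+1.
        rewrite /X -map_comp; congr (num_words _ _).
        apply/eq_in_map => q /(allP HQ) /andP[/andP[? ?] ?] /=.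
        by congr (_, _); lia.
      over.
    over.
  rewrite /=; under eq_bigr => u _ do rewrite big_distrr.
  rewrite exchange_big /=; apply: eq_bigr => r _.
  case: t {IHd} => [|t]; first by rewrite big_ord0 muln0.
  rewrite -ballot_convolution mulnC mulnA big_distrr /=.
  rewrite (reindex_inj rev_ord_inj) /=; apply: eq_bigr => u _.
  have := ltn_ord u => lt_ut.
  have -> : t - (t.+1 - u.+1) = u by lia.
  by rewrite subSS; lia.
have -> : \sum_(r < j.+1) ballot j.+1 r.+1 * ballot t r * X r
        = \sum_(r < j.+2) ballot j.+1 r.+1 * ballot t r * X r.
  by rewrite [RHS]big_ord_recr /= (@ballot_gt j.+1 j.+2) // !mul0n addn0.
rewrite big_ord_recl [RHS]big_ord_recl -addnA ballot_S0; congr (_ + _).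
rewrite -big_split; apply: eq_bigr => r _; rewrite !lift0 /=.
by rewrite (ballot_pascal j r) -/(X r.+1) !mulnDl addnC.
Qed.

(** * One-line notation of permutations *)

Definition one_line M (s : 'S_M) : seq nat := [seq (s i).+1 | i <- enum 'I_M].

Lemma size_one_line M (s : 'S_M) : size (one_line s) = M.
Proof. by rewrite size_map size_enum_ord. Qed.

Lemma nth_one_line M (s : 'S_M) (i : 'I_M) : nth 0 (one_line s) i = (s i).+1.
Proof. by rewrite (nth_map i) ?size_enum_ord // nth_ord_enum. Qed.

Lemma one_line_inj M : injective (@one_line M).
Proof.
move=> s s' E; apply/permP => i; apply/val_inj/succn_inj.
by rewrite -!nth_one_line E.
Qed.

Lemma av312_one_line M (s : 'S_M) : av312 (one_line s) = avoids312 s.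
Proof.
apply/av312P/idP => [H|/existsPn H i1 i2 i3 lt12 lt23].
  apply/existsPn => i1; apply/existsPn => i2; apply/existsPn => i3.
  apply/negP => /and4P[lt12 lt23 s23 s31].
  have := H _ _ _ lt12 lt23; rewrite size_one_line !nth_one_line !ltnS s23 s31.
  by move/(_ (ltn_ord i3)).
rewrite size_one_line => lt3.
have lt2 := ltn_trans lt23 lt3; have lt1 := ltn_trans lt12 lt2.
rewrite -[i1]/(val (Ordinal lt1)) -[i2]/(val (Ordinal lt2)).
rewrite -[i3]/(val (Ordinal lt3)) !nth_one_line !ltnS.
have /existsPn/(_ (Ordinal lt2))/existsPn/(_ (Ordinal lt3)) := H (Ordinal lt1).
by rewrite /= lt12 lt23.
Qed.

Lemma one_line_words M (s : 'S_M) : (one_line s \in words M) = avoids312 s.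
Proof.
rewrite mem_words av312_one_line andb_idr // => _; apply: uniq_perm.
- by rewrite map_inj_uniq ?enum_uniq // => i k [/val_inj/perm_inj].
- exact: iota_uniq.
move=> x; rewrite mem_iota; apply/mapP/idP => [[i _ ->]|].
  by rewrite add1n /=; apply: ltn_ord.
case: x => //= x; rewrite add1n ltnS => lt_x.
by exists (s^-1 (Ordinal lt_x))%g; rewrite ?mem_enum ?permKV.
Qed.

Lemma words_one_line M w : w \in words M -> exists s : 'S_M, w = one_line s.
Proof.
move=> ww; have lt_w (i : 'I_M) : (nth 0 w i).-1 < M.
  have := nth_word_le i.+1 ww; have := nth_word_gt0 ww (ltn_ord i).
  by rewrite /=; lia.
have w_inj : injective (fun i => Ordinal (lt_w i)).
  move=> i k [E]; have := nth_word_gt0 ww (ltn_ord i).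
  have := nth_word_gt0 ww (ltn_ord k) => gtk gti.
  have {}E : nth 0 w i = nth 0 w k by lia.
  have w_uniq : uniq w.
    by move: ww; rewrite mem_words => /andP[_ /perm_uniq ->]; exact: iota_uniq.
  apply/val_inj/eqP; rewrite -(@nth_uniq _ 0 w) ?(size_word ww) ?E //.
    exact: ltn_ord.
  exact: ltn_ord.
exists (perm w_inj); apply: (@eq_from_nth _ 0).
  by rewrite size_one_line (size_word ww).
rewrite (size_word ww) => i lt_i; rewrite -[i]/(val (Ordinal lt_i)).
by rewrite nth_one_line permE /= prednK // (nth_word_gt0 ww).
Qed.

Lemma hit_one_line M (s : 'S_M) x y : 0 < y ->
  hit (one_line s) (x, y) = [exists i : 'I_M, (i.+1 == x) && ((s i).+1 == y)].
Proof.
move=> y_gt0; rewrite /hit /=.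
apply/eqP/existsP => [E|[i /andP[/eqP <- /eqP <-]]].
  case: x E => [E|x] /=; first by rewrite -E in y_gt0.
  have [lt_x|le_x] := ltnP x M; last first.
    by rewrite nth_default ?size_one_line // => E; rewrite -E in y_gt0.
  rewrite -[x]/(val (Ordinal lt_x)) nth_one_line => <-.
  by exists (Ordinal lt_x); rewrite !eqxx.
exact: nth_one_line.
Qed.

Lemma card_Sdesc M m p v : (forall a, 1 <= a <= m -> 0 < v a) ->
  #|Sdesc M m p v| = num_words M [seq (p a, v a) | a <- iota 1 m].
Proof.
move=> v_gt0; rewrite /num_words -size_filter cardE -(size_map (@one_line M)).
apply/perm_size/uniq_perm.
- by rewrite (map_inj_uniq (@one_line_inj M)) enum_uniq.
- exact/filter_uniq/words_uniq.
have mem_s (s : 'S_M) : (s \in Sdesc M m p v) =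
    all (hit (one_line s)) [seq (p a, v a) | a <- iota 1 m]
    && (one_line s \in words M).
  rewrite inE one_line_words andbC; congr (_ && _).
  rewrite all_map; apply/forallP/allP => [H a|H a] /=.
    rewrite mem_iota => Ha; rewrite hit_one_line; last by apply: v_gt0; lia.
    have lt_a : a.-1 < m by lia.
    by have := H (Ordinal lt_a); rewrite /= prednK //; lia.
  have Ha : 1 <= a.+1 <= m by rewrite /= ltn_ord.
  rewrite -hit_one_line; last exact: v_gt0.
  by apply: H; rewrite mem_iota; lia.
move=> w; rewrite mem_filter; apply/mapP/idP => [[s]|].
  by rewrite mem_enum mem_s => ? ->.
case/andP => Hw ww; have [s E] := words_one_line ww.
by exists s; rewrite // mem_enum mem_s -E Hw.
Qed.

Local Open Scope ring_scope.

(** * The lowest point in closed form *)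

Lemma ballotE n r : (r <= n)%N ->
  (ballot n r)%:R = r.+1%:R / n.+1%:R * 'C(2 * n - r, n)%:R :> rat.
Proof.
move=> le_rn; apply: (@mulfI _ n.+1%:R); first by rewrite pnatr_eq0.
rewrite -natrM mul_ballot // natrM mulrA [_ / _]mulrC mulVKf ?pnatr_eq0 //.
Qed.

Lemma catalanE n : catalan n = (ballot n 0)%:R.
Proof. by rewrite ballotE // subn0 /catalan mul1r. Qed.

(** The substitution [i = j - r] in the closed form; the summands with
    [i < j - t], that is [r > t], vanish. *)
Lemma num_words_lowest_rat p j t Q : (0 < j < p)%N ->
    all (fun q => (j <= q.1 < p) && (j < q.2))%N Q ->
  (num_words (p + t) ((p, j) :: Q))%:R =
  \sum_(maxn 1 (j - t) <= i < j.+1)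
    ((j - i + 1)%N%:R ^+ 2 / (j * (t + 1))%N%:R
     * 'C(i + 2 * t - j, t)%:R * 'C(i + j - 2, j - 1)%:R
     * (num_words (p - i) [seq (q.1 - i + 1, q.2 - j)%N | q <- Q])%:R) :> rat.
Proof.
move=> lt_jp HQ; rewrite num_words_lowest // natr_sum.
pose F i := (ballot j.-1 (j - i) * ballot t (j - i) *
     num_words (p - i) [seq (q.1 - i + 1, q.2 - j)%N | q <- Q])%:R : rat.
transitivity (\sum_(0 <= i < j) F i.+1).
  rewrite big_mkord (reindex_inj rev_ord_inj) /=; apply: eq_bigr => r _.
  have := ltn_ord r => lt_r; rewrite /F.
  have E : (j - (j - r.+1) = r.+1)%N by lia.
  by rewrite !E.
rewrite -(big_add1 _ _ 0 j.+1 xpredT F).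
rewrite (@big_cat_nat _ _ _ (maxn 1 (j - t))) /=; [|lia|lia].
rewrite big_nat big1 ?add0r => [|i /andP[i_gt0 lt_i]]; last first.
  by rewrite /F (@ballot_gt t) ?muln0 //; lia.
apply: eq_big_nat => i /andP[ge_i le_i]; rewrite /F !natrM.
rewrite !ballotE; [|lia|lia].
have -> : (2 * j.-1 - (j - i) = i + j - 2)%N by lia.
have -> : (2 * t - (j - i) = i + 2 * t - j)%N by lia.
have Ej : j.-1.+1 = j by lia.
rewrite Ej -subn1 !addn1.
have j0 : j%:R != 0 :> rat by rewrite pnatr_eq0; lia.
have t0 : t.+1%:R != 0 :> rat by rewrite pnatr_eq0.
by field; rewrite j0 nat1r t0.
Qed.

(** One removal step on permutations.  For [k = 1] it counts the permutations
    through a single point, which is the inner sum when [k = 2] points are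
    removed one after the other. *)
Lemma card_Sdesc_lowest k M t p v :
    (0 < k)%N -> M = (p k + t)%N -> (0 < v k < p k)%N ->
    (forall a, 1 <= a < k -> (v k <= p a < p k) && (v k < v a))%N ->
  #|Sdesc M k p v|%:R =
  \sum_(maxn 1 (v k - t) <= i < (v k).+1)
    ((v k - i + 1)%N%:R ^+ 2 / (v k * (t + 1))%N%:R
     * 'C(i + 2 * t - v k, t)%:R * 'C(i + v k - 2, v k - 1)%:R
     * #|Sdesc (p k - i) (k - 1) (fun a => (p a - i + 1)%N)
          (fun a => (v a - v k)%N)|%:R) :> rat.
Proof.
move=> k_gt0 -> lt_vp Hpv.
have Hv a : (1 <= a <= k -> 0 < v a)%N.
  move=> Ha; have [->|ne_ak] := eqVneq a k; first by lia.
  by have := Hpv a; lia.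
rewrite card_Sdesc //.
have -> : num_words (p k + t) [seq (p a, v a) | a <- iota 1 k] =
          num_words (p k + t)
            ((p k, v k) :: [seq (p a, v a) | a <- iota 1 (k - 1)]).
  have -> : iota 1 k = iota 1 (k - 1) ++ [:: k].
    by rewrite -[in LHS](subnK k_gt0) iotaD subnKC.
  by apply: eq_count => s; rewrite map_cat all_cat /= andbT andbC.
rewrite num_words_lowest_rat //; last first.
  apply/allP => _ /mapP[a Ha ->] /=; apply: Hpv.
  by move: Ha; rewrite mem_iota; lia.
apply: eq_big_nat => i _; congr (_ * _%:R).
rewrite card_Sdesc => [|a Ha]; last by have := Hpv a; lia.
by rewrite -map_comp.
Qed.

Local Close Scope ring_scope.

(* The indices 1, ..., k of j and t are those of the paper.  All truncated
   subtractions below have nonnegative integer values under the hypotheses,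
   except j k - t k and its analogue, which only occur inside max(1, _). *)
Theorem theorem2p8 (k N : nat) (j t : nat -> nat)
  (k_ge2 : 2 <= k)
  (N_ge1 : 1 <= N)
  (j_ge1 : forall a : nat, 1 <= a <= k -> 1 <= j a)
  (j_decr : forall a : nat, 1 <= a < k -> j a.+1 < j a)
  (j_lt_pos : j 1 < N - t 1)
  (pos_incr : forall a : nat, 1 <= a < k -> N - t a < N - t a.+1) :
  (#|Sdesc N k (fun a => (N - t a)%N) j|%:R =
     \sum_(maxn 1 (j k - t k) <= i < (j k).+1)
        ((j k - i + 1)%N%:R ^+ 2 / (j k * (t k + 1))%N%:R
         * 'C(i + 2 * t k - j k, t k)%:R
         * 'C(i + j k - 2, j k - 1)%:R
         * #|Sdesc (N - t k - i) (k - 1) (fun a => (N - t a - i + 1)%N)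
               (fun a => (j a - j k)%N)|%:R) :> rat)%R
  /\
  (k = 2 ->
   (#|Sdesc N 2 (fun a => (N - t a)%N) j|%:R =
     \sum_(maxn 1 (j 2%N - t 2%N) <= i1 < (j 2%N).+1)
        ((j 2%N - i1 + 1)%N%:R ^+ 2 / (j 2%N * (t 2%N + 1))%N%:R
         * 'C(i1 + 2 * t 2%N - j 2%N, t 2%N)%:R
         * 'C(i1 + j 2%N - 2, j 2%N - 1)%:R
         * \sum_(maxn 1 ((j 1%N - j 2%N) - (t 1%N - t 2%N - 1))
                   <= i0 < (j 1%N - j 2%N).+1)
              (catalan (N - t 1%N - i1 - i0 + 1)
               * ((j 1%N - j 2%N - i0 + 1)%N%:R ^+ 2
                  / ((j 1%N - j 2%N) * (t 1%N - t 2%N))%N%:R)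
               * 'C(i0 + 2 * (t 1%N - t 2%N - 1) - (j 1%N - j 2%N), t 1%N - t 2%N - 1)%:R
               * 'C(i0 + (j 1%N - j 2%N) - 2, j 1%N - j 2%N - 1)%:R)) :> rat)%R).
Proof.
have posM a b : 1 <= a -> a < b <= k -> N - t a < N - t b.
  move=> a_gt0; elim: b => [|b IHb]; first by lia.
  rewrite ltnS => /andP[]; rewrite leq_eqVlt => /orP[/eqP <- lt_ak|lt_ab lt_bk].
    by apply: pos_incr; lia.
  apply: ltn_trans (IHb _) (pos_incr b _); lia.
have jM a b : 1 <= a -> a < b <= k -> j b < j a.
  move=> a_gt0; elim: b => [|b IHb]; first by lia.
  rewrite ltnS => /andP[]; rewrite leq_eqVlt => /orP[/eqP <- lt_ak|lt_ab lt_bk].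
    by apply: j_decr; lia.
  apply: ltn_trans (j_decr b _) (IHb _); lia.
have lt_1k : N - t 1 < N - t k by apply: posM; lia.
have lt_j1k : j k < j 1 by apply: jM; lia.
have jk_gt0 : 0 < j k by apply: j_ge1; lia.
have main := @card_Sdesc_lowest k N (t k) (fun a => N - t a) j.
have Hpts a : 1 <= a < k -> (j k <= N - t a < N - t k) && (j k < j a).
  move=> Ha; have : N - t a < N - t k by apply: posM; lia.
  have : j k < j a by apply: jM; lia.
  have [->|ne_a1] := eqVneq a 1; first by lia.
  have : N - t 1 < N - t a by apply: posM; lia.
  by lia.
split=> [|k2].
  by rewrite main //; lia.
(* After the removal of both points no constraint is left, whence the Catalan
   numbers. *)
subst k; rewrite main //; [rewrite -[2 - 1]/1 | lia..].
apply: eq_big_nat => i1 /andP[ge_i1 le_i1]; congr (_ * _)%R.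
rewrite (@card_Sdesc_lowest _ _ (t 1 - t 2 - 1)) //=; [|lia..].
apply: eq_big_nat => i0 /andP[ge_i0 le_i0].
rewrite card_Sdesc; last by lia.
rewrite num_words_nil -catalanE.
rewrite (_ : N - t 1 - i1 + 1 - i0 = N - t 1 - i1 - i0 + 1); last by lia.
rewrite (_ : t 1 - t 2 - 1 + 1 = t 1 - t 2); last by lia.
by rewrite mulrC !mulrA.
Qed.
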